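(* For all integers $n \ge 1$ and $k \ge 0$, there is a bijection between the set of evil-avoiding permutations in $S_n$ with exactly $k$ recoils and the set of rectangular permutations in $S_n$ with exactly $k$ recoils.
   Context: A permutation $\pi\in S_n$ is written in one-line form $[\pi_1\,\pi_2\cdots\pi_n]$. It contains a pattern $\sigma\in S_m$ if some subsequence of $\pi$ of length $m$ has the same relative order as $\sigma$; otherwise it avoids $\sigma$. A permutation is evil-avoiding if it avoids $2413$, $4132$, $4213$ and $3214$. A permutation is rectangular if it avoids $2413$, $2431$, $4213$ and $4231$. A recoil of $\pi\in S_n$ is a value $i\in\{1,\dots,n-1\}$ such that $i+1$ occurs before $i$ in $\pi$ (equivalently, $\pi^{-1}_i>\pi^{-1}_{i+1}$). *)

(* Defs.v *)
From mathcomp Require Import all_boot all_fingroup.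
Set Implicit Arguments. Unset Strict Implicit. Unset Printing Implicit Defensive.

(* Permutations of S_n are elements of {perm 'I_n}; one-line form
   [pi_1 ... pi_n] is (pi 0, ..., pi (n-1)) shifted by one (0-based). *)

(* A pattern is given in one-line form as a sequence of (1-based) values;
   only relative order matters.  pi contains sigma (of length m) if there
   are positions i_1 < ... < i_m (a strictly increasing map 'I_m -> 'I_n)
   whose values have the same relative order as sigma. *)
Definition contains (n : nat) (pi : {perm 'I_n}) (sigma : seq nat) : Prop :=
  exists f : 'I_(size sigma) -> 'I_n,
    (forall a b : 'I_(size sigma), (a < b)%N -> (f a < f b)%N) /\
    (forall a b : 'I_(size sigma),
        (pi (f a) < pi (f b))%N = (nth 0 sigma a < nth 0 sigma b)%N).

Definition avoids (n : nat) (pi : {perm 'I_n}) (sigma : seq nat) : Prop :=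
  ~ contains pi sigma.

Definition evil_avoiding (n : nat) (pi : {perm 'I_n}) : Prop :=
  [/\ avoids pi [:: 2; 4; 1; 3], avoids pi [:: 4; 1; 3; 2],
      avoids pi [:: 4; 2; 1; 3] & avoids pi [:: 3; 2; 1; 4]].

Definition rectangular (n : nat) (pi : {perm 'I_n}) : Prop :=
  [/\ avoids pi [:: 2; 4; 1; 3], avoids pi [:: 2; 4; 3; 1],
      avoids pi [:: 4; 2; 1; 3] & avoids pi [:: 4; 2; 3; 1]].

(* Recoil i (1-based, 1 <= i <= n-1): i+1 occurs before i in pi.
   In 0-based values: j < n-1 with pi^{-1}(j+1) < pi^{-1}(j). *)
Definition is_recoil (n : nat) (pi : {perm 'I_n}) (j : 'I_n) : bool :=
  [exists j' : 'I_n, (val j' == (val j).+1) && ((pi^-1)%g j' < (pi^-1)%g j)%N].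

Definition recoils (n : nat) (pi : {perm 'I_n}) : nat :=
  #|[set j : 'I_n | is_recoil pi j]|.

(* Main.v *)
Require Import Defs.
From mathcomp Require Import all_boot all_fingroup all_algebra zify ring.

(** Both classes have generating polynomials [A_n(X)], where [X] marks recoils,
    determined by the same recurrences: if [U_n] counts the members not starting
    with their minimum, then [A_(n+1) = A_n + U_(n+1)] and
    [U_(n+2) = X A_n + (2 + X) U_(n+1)].

    A permutation is rectangular iff no two entries 2, 4 both precede the two
    entries 1, 3; so if it starts with [v w] and [v] is not the minimum 0, then
    [w] is 0, [v-1] or [v+1], and each case is an insertion into a smaller
    rectangular permutation.

    For evil-avoiding permutations, an entry 0 that is last, or that is followed
    by 1, can be removed freely.  Otherwise (class [W], [linked] below) either
    the permutation starts with [1 0], which is removed, or it starts with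
    [v v+1], which is contracted, or it starts with [v 0] with [v >= 2].  In the
    last case removing 0 yields an initial ascent [v w], [v] not minimal, with all
    entries below [v] in increasing order (class [M], [rising] below).  Applying
    the same deletions to [M] gives [M_(n+1) = X A_(n-1) + M_n + W_n], which is
    also the recurrence of [W], so [M = W] and [W_(n+1) = U_n]. *)

Set Implicit Arguments. Unset Strict Implicit. Unset Printing Implicit Defensive.
Import GRing.Theory.

(** * Insertion of an entry into a permutation *)

(* Extending a permutation of ['I_n] by the identity to all of [nat] keeps
   positions and values in [nat], where [lia] applies. *)
Definition app (n : nat) (s : 'S_n) (i : nat) : nat :=
  if insub i is Some k then val (s k) else i.

Lemma app_ord n (s : 'S_n) (k : 'I_n) : app s k = s k.
Proof. by rewrite /app valK. Qed.

Lemma app_ge n (s : 'S_n) i : n <= i -> app s i = i.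
Proof. by move=> h; rewrite /app insubF // ltnNge h. Qed.

Lemma app_lt n (s : 'S_n) i : (app s i < n) = (i < n).
Proof.
case: (ltnP i n) => h; last by rewrite app_ge // ltnNge h.
by rewrite -[i]/(val (Ordinal h)) app_ord ltn_ord.
Qed.

Lemma appK n (s : 'S_n) : cancel (app s) (app s^-1).
Proof.
move=> i; case: (ltnP i n) => h; last by rewrite !app_ge.
by rewrite -[i]/(val (Ordinal h)) !app_ord permK.
Qed.

Lemma appVK n (s : 'S_n) : cancel (app s^-1) (app s).
Proof. by move=> i; rewrite -{1}(invgK s) appK. Qed.

Lemma app_inj n (s : 'S_n) : injective (app s).
Proof. exact: can_inj (@appK n s). Qed.

Lemma app_ext n (s t : 'S_n) : app s =1 app t -> s = t.
Proof. by move=> h; apply/permP => k; apply: val_inj; rewrite /= -!app_ord h. Qed.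

(* Only meaningful for [i, j <= n], because of [inord]. *)
Definition ins (n i j : nat) (s : 'S_n) : 'S_n.+1 :=
  lift_perm (inord i) (inord j) s.

Lemma insV n i j (s : 'S_n) : ((ins i j s)^-1)%g = ins j i s^-1.
Proof. exact: lift_permV. Qed.

Lemma app_ins n i j (s : 'S_n) k : i <= n -> j <= n ->
  app (ins i j s) k = if k == i then j else bump j (app s (unbump i k)).
Proof.
move=> hi hj; case: (ltnP k n.+1) => hk; last first.
  rewrite app_ge // ifF; last by lia.
  by rewrite app_ge /bump /unbump; lia.
have [K ->] : exists K : 'I_n.+1, k = K by exists (Ordinal hk).
rewrite app_ord /ins; case: (unliftP (inord i) K) => [k' ->|->].
  rewrite lift_perm_lift /= !inordK // bumpK app_ord ifF //.
  by rewrite /bump; lia.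
by rewrite lift_perm_id /= !inordK // eqxx.
Qed.

(** Agreement in position or in value is enough, since equality of the two permutations forces the
    other coordinate. The inserted value may thus depend on [s]. *)
Lemma ins_inj n i j i' j' (s t : 'S_n) : i <= n -> j <= n -> i' <= n ->
  j' <= n -> i = i' \/ j = j' -> ins i j s = ins i' j' t -> s = t.
Proof.
move=> hi hj hi' hj' hij e.
have [ei ej] : i = i' /\ j = j'.
  have ai : app (ins i j s) i = j by rewrite app_ins // eqxx.
  have ai' : app (ins i' j' t) i' = j' by rewrite app_ins // eqxx.
  case: hij => ?; subst; split=> //; first by rewrite -ai e.
  by apply: (@app_inj _ (ins i j' s)); rewrite ai e.
subst; apply: app_ext => k; have := congr1 (fun p => app p (bump i' k)) e.
have ne : (bump i' k == i') = false by rewrite /bump; lia.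
by rewrite !app_ins // ne bumpK => /(can_inj (bumpK _)).
Qed.

Lemma ins_surj n (p : 'S_n.+1) i : i <= n ->
  exists s : 'S_n, p = ins i (app p i) s.
Proof.
move=> hi.
have hj : app p i <= n by rewrite -ltnS app_lt.
(* Deleting the entry unlifts around both its position and its value. The default [k] is never
   reached, because no other position carries the value [app p i]. *)
have inj : injective (fun k : 'I_n =>
    odflt k (unlift (inord (app p i)) (p (lift (inord i) k)))).
  have ne (k : 'I_n) : inord (app p i) != p (lift (inord i) k).
    rewrite (_ : inord (app p i) = p (inord i)).
      by rewrite (inj_eq perm_inj) neq_lift.
    by apply: val_inj; rewrite /= inordK // -app_ord inordK.
  move=> k l /=.
  have [k' ek _] := unlift_some (ne k); have [l' el _] := unlift_some (ne l).
  rewrite ek el !liftK /= => e.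
  by apply: (@lift_inj _ (inord i)); apply: (@perm_inj _ p); rewrite ek el e.
exists (perm inj); apply/permP => k; rewrite /ins.
case: (unliftP (inord i) k) => [k' ->|->].
  rewrite lift_perm_lift permE.
  case: unliftP => [l -> //|e].
  have : p (inord i) = p (lift (inord i) k').
    by rewrite e; apply: val_inj; rewrite /= inordK // -app_ord inordK.
  by move/perm_inj/eqP; rewrite (negPf (neq_lift _ _)).
by rewrite lift_perm_id; apply: val_inj; rewrite /= inordK // -app_ord inordK.
Qed.

(** * Recoils under insertion *)

Lemma recoilsE n (s : 'S_n.+1) :
  recoils s = \sum_(a < n) (app s^-1 a.+1 < app s^-1 a).
Proof.
rewrite /recoils -sum1dep_card big_mkcond /= big_ord_recr /=.
rewrite [X in _ + X](_ : _ = 0) ?addn0.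
  apply: eq_bigr => a _; rewrite (_ : is_recoil _ _ = (app s^-1 a.+1 < app s^-1 a)).
    by case: (_ < _).
  apply/existsP/idP => [[j /andP[/eqP ej]]|h].
    by rewrite -!app_ord ej.
  exists (lift ord0 a); rewrite -!app_ord.
  by apply/andP; split; [apply/eqP|].
case: ifP => // /existsP[j /andP[/eqP ej _]].
by have := ltn_ord j; rewrite /= in ej *; lia.
Qed.

(** An insertion creates one more pair of consecutive values. Here [u], [u.+1] is taken as the new
    pair, and [bump u] numbers the old ones. *)
Lemma recoils_skip n (s : 'S_n.+1) (p : 'S_n.+2) u : u <= n ->
  (forall a, a < n -> (app p^-1 (bump u a).+1 < app p^-1 (bump u a)) =
                      (app s^-1 a.+1 < app s^-1 a)) ->
  recoils p = recoils s + (app p^-1 u.+1 < app p^-1 u).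
Proof.
move=> hu h; rewrite !recoilsE (bigD1_ord (Ordinal (hu : u < n.+1))) //= addnC.
by congr (_ + _); apply: eq_bigr => a _; rewrite /= h.
Qed.

(** The new pair is 0, 1, and 1 is the old 0: it is a recoil exactly when the old 0 stood before the
    insertion point. *)
Lemma recoils_ins0 n (s : 'S_n.+1) i : i <= n.+1 ->
  recoils (ins i 0 s) = recoils s + (app s^-1 0 < i).
Proof.
move=> hi; pose f := app (ins i 0 s)^-1.
have f0 : f 0 = i by rewrite /f insV app_ins.
have fS a : f a.+1 = bump i (app s^-1 a).
  by rewrite /f insV app_ins //= /unbump /= subn1.
rewrite (@recoils_skip _ s _ 0) -/f // => [|a _]; last first.
  by rewrite (_ : bump 0 a = a.+1) // !fS /bump; lia.
by rewrite f0 fS /bump; congr (_ + _); lia.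
Qed.

Lemma app_V0 n (s : 'S_n.+1) i : (app s^-1 i == 0) = (i == app s 0).
Proof. by rewrite -{2}(appVK s i) (inj_eq (@app_inj _ s)). Qed.

(** The new pair [v], [v+1] opens the permutation in increasing order. The pair [v-1], [v] is a
    recoil before and after, as its upper value comes first. *)
Lemma recoils_ins_before n (s : 'S_n.+1) :
  recoils (ins 0 (app s 0) s) = recoils s.
Proof.
have hv : app s 0 <= n by rewrite -ltnS app_lt.
pose f := app (ins 0 (app s 0) s)^-1; pose h := app s^-1.
have fE k : f k = if k == app s 0 then 0 else (h (unbump (app s 0) k)).+1.
  by rewrite /f insV app_ins // leqW.
have h0 k : (h k == 0) = (k == app s 0) by apply: app_V0.
rewrite (@recoils_skip _ s _ (app s 0)) // -/f -/h => [|a _].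
  by rewrite !fE /unbump eqxx; lia.
have := h0 a; have := h0 a.+1; rewrite !fE.
have -> : unbump (app s 0) (bump (app s 0) a).+1 = a.+1 by rewrite /bump /unbump; lia.
by rewrite bumpK /bump; do 2!case: ifP; lia.
Qed.

(** The permutation now opens with [v+1], [v], a new recoil. The old pair [v], [v+1] becomes [v+1],
    [v+2]; its lower value is first both times, so it is never a recoil. *)
Lemma recoils_ins_after n (s : 'S_n.+1) :
  recoils (ins 0 (app s 0).+1 s) = (recoils s).+1.
Proof.
have hv : app s 0 <= n by rewrite -ltnS app_lt.
pose f := app (ins 0 (app s 0).+1 s)^-1; pose h := app s^-1.
have fE k : f k = if k == (app s 0).+1 then 0 else (h (unbump (app s 0).+1 k)).+1.
  by rewrite /f insV app_ins.
have h0 k : (h k == 0) = (k == app s 0) by apply: app_V0.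
rewrite (@recoils_skip _ s _ (app s 0)) // -/f -/h => [|a _].
  by rewrite !fE /unbump eqxx; case: ifP; lia.
have := h0 a; have := h0 a.+1; rewrite !fE.
case: (eqVneq a (app s 0)) => [->|ne].
  have -> : unbump (app s 0).+1 (bump (app s 0) (app s 0)).+1 = (app s 0).+1.
    by rewrite /bump /unbump; lia.
  by rewrite /bump; do 2!case: ifP; lia.
have -> : unbump (app s 0).+1 (bump (app s 0) a).+1 = a.+1 by rewrite /bump /unbump; lia.
have -> : unbump (app s 0).+1 (bump (app s 0) a) = a by rewrite /bump /unbump; lia.
by rewrite /bump; do 2!case: ifP; lia.
Qed.

(** * Avoidance of patterns of length four *)

(** One boolean predicate on four values encodes a whole set of patterns, so that the class can
    index a sum. *)
Definition avoid4 (Q : nat -> nat -> nat -> nat -> bool) n (s : 'S_n) : bool :=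
  [forall i : 'I_n, forall j : 'I_n, forall k : 'I_n, forall l : 'I_n,
     [&& i < j, j < k & k < l] ==> ~~ Q (s i) (s j) (s k) (s l)].

Lemma avoid4P Q n (s : 'S_n) :
  reflect (forall i j k l, i < j -> j < k -> k < l -> l < n ->
             ~~ Q (app s i) (app s j) (app s k) (app s l)) (avoid4 Q s).
Proof.
apply: (iffP idP) => [h i j k l ij jk kl ln | h].
  have kn := ltn_trans kl ln; have jn := ltn_trans jk kn.
  have iN := ltn_trans ij jn.
  move: h => /forallP/(_ (Ordinal iN))/forallP/(_ (Ordinal jn)).
  move=> /forallP/(_ (Ordinal kn))/forallP/(_ (Ordinal ln)).
  by rewrite -!app_ord /= ij jk kl.
apply/forallP=> i; apply/forallP=> j; apply/forallP=> k; apply/forallP=> l.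
by apply/implyP=> /and3P[ij jk kl]; rewrite -!app_ord; apply: h.
Qed.

Section Insertion.
Variable Q : nat -> nat -> nat -> nat -> bool.
Hypothesis Q_bump : forall h a b c d,
  Q (bump h a) (bump h b) (bump h c) (bump h d) = Q a b c d.

Lemma avoid4_del n i j (s : 'S_n) : avoid4 Q (ins i j s) -> avoid4 Q s.
Proof.
have [hi hj] : (inord i : 'I_n.+1) <= n /\ (inord j : 'I_n.+1) <= n.
  by split; rewrite -ltnS.
(* No bounds on [i] and [j] are assumed, so they are replaced by the indices that [inord] actually
   produces. *)
rewrite (_ : ins i j s = ins (inord i : 'I_n.+1) (inord j : 'I_n.+1) s); last first.
  by rewrite /ins !inord_val.
move: (inord i : nat) (inord j : nat) hi hj => {}i {}j hi hj /avoid4P h.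
apply/avoid4P => a b c d ab bc cd dn.
have E k : app (ins i j s) (bump i k) = bump j (app s k).
  by rewrite app_ins // bumpK ifF // /bump; lia.
have := h (bump i a) (bump i b) (bump i c) (bump i d).
by rewrite !E Q_bump /bump; apply; lia.
Qed.

(** An occurrence that misses position [i] already lives in [s]. It therefore suffices to reroute
    each occurrence through [i] to one that misses it. *)
Lemma avoid4_ins n i j (s : 'S_n) : i <= n -> j <= n -> avoid4 Q s ->
  (forall a b c d, a < b -> b < c -> c < d -> d <= n ->
     let f := app (ins i j s) in
     Q (f a) (f b) (f c) (f d) -> i \in [:: a; b; c; d] ->
     exists a' b' c' d', [&& a' < b', b' < c', c' < d', d' <= n,
       i \notin [:: a'; b'; c'; d'] & Q (f a') (f b') (f c') (f d')]) ->
  avoid4 Q (ins i j s).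
Proof.
move=> hi hj /avoid4P h H.
have E k : k != i -> app (ins i j s) k = bump j (app s (unbump i k)).
  by move=> ne; rewrite app_ins // ifF //; apply: negPf.
have K a b c d : a < b -> b < c -> c < d -> d <= n ->
    i \notin [:: a; b; c; d] -> let f := app (ins i j s) in
    ~~ Q (f a) (f b) (f c) (f d).
  move=> ab bc cd dn; rewrite !inE !negb_or => /and4P[ia ib ic id] /=.
  rewrite !E 1?eq_sym // Q_bump; apply: h; rewrite /unbump; lia.
apply/avoid4P => a b c d ab bc cd dn.
case: (boolP (i \in [:: a; b; c; d])) => hin; last by apply: K.
apply/negP => q; have [a' [b' [c' [d']]]] := H _ _ _ _ ab bc cd dn q hin.
move=> /and5P[ab' bc' cd' dn' /andP[ni q']].
by move: q'; apply/negP; apply: K.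
Qed.

End Insertion.

(** Each clause lists the entries of one pattern by increasing value; the patterns are 2413, 4132,
    4213, 3214 in this order. *)
Definition evil4 a b c d :=
  [|| [&& c < a, a < d & d < b], [&& b < d, d < c & c < a],
      [&& c < b, b < d & d < a] | [&& c < b, b < a & a < d]].

(** The clauses are 2413, 2431, 4213, 4231: the predicate is symmetric in [a], [b] and in [c],
    [d]. *)
Definition rect4 a b c d :=
  [|| [&& c < a, a < d & d < b], [&& d < a, a < c & c < b],
      [&& c < b, b < d & d < a] | [&& d < b, b < c & c < a]].

Lemma ltn_bump h a b : (bump h a < bump h b) = (a < b).
Proof. by rewrite /bump; lia. Qed.

Lemma evil4_bump h a b c d :
  evil4 (bump h a) (bump h b) (bump h c) (bump h d) = evil4 a b c d.
Proof. by rewrite /evil4 !ltn_bump. Qed.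

Lemma rect4_bump h a b c d :
  rect4 (bump h a) (bump h b) (bump h c) (bump h d) = rect4 a b c d.
Proof. by rewrite /rect4 !ltn_bump. Qed.

Definition same_order (sigma w : seq nat) : bool :=
  all (fun a => all (fun b => (nth 0 w a < nth 0 w b) ==
                              (nth 0 sigma a < nth 0 sigma b))
                    (iota 0 (size sigma))) (iota 0 (size sigma)).

Lemma contains4P n (s : 'S_n) x y z t :
  contains s [:: x; y; z; t] <->
  exists i j k l, [/\ i < j, j < k, k < l & l < n] /\
    same_order [:: x; y; z; t] [:: app s i; app s j; app s k; app s l].
Proof.
split=> [[f [f_mono f_ord]] | [i [j [k [l [[ij jk kl ln] /allP so]]]]]].
  pose o m (h : m < 4) : 'I_4 := Ordinal h.
  exists (f (o 0 isT)), (f (o 1 isT)), (f (o 2 isT)), (f (o 3 isT)); split.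
    by split; rewrite ?ltn_ord //; apply: f_mono.
  have E (a : 'I_4) : nth 0 [:: app s (f (o 0 isT)); app s (f (o 1 isT));
      app s (f (o 2 isT)); app s (f (o 3 isT))] a = s (f a).
    by case: a => -[|[|[|[|m]]]] // h /=; rewrite app_ord; do 3!congr (_ _); apply: val_inj.
  apply/allP => a; rewrite mem_iota => /andP[_ ha].
  apply/allP => b; rewrite mem_iota => /andP[_ hb].
  by rewrite (E (o a ha)) (E (o b hb)) f_ord.
have kn := ltn_trans kl ln; have jn := ltn_trans jk kn.
have iN := ltn_trans ij jn.
pose g := [:: i; j; k; l].
have gn (a : 'I_4) : nth 0 g a < n by case: a => -[|[|[|[|m]]]].
exists (fun a => Ordinal (gn a)); split=> [[a ha] [b hb] /=|[a ha] [b hb]].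
  case: a ha => [|[|[|[|a]]]] //; case: b hb => [|[|[|[|b]]]] //= *; lia.
rewrite -!app_ord.
have /so/allP/(_ b) : a \in iota 0 4 by rewrite mem_iota.
rewrite mem_iota => /(_ hb)/eqP <-.
by case: a ha => [|[|[|[|a]]]] //; case: b hb => [|[|[|[|b]]]].
Qed.

Lemma evil_avoidingP n (s : 'S_n) : reflect (evil_avoiding s) (avoid4 evil4 s).
Proof.
apply: (iffP (avoid4P _ _)) => [h|[h1 h2 h3 h4] i j k l ij jk kl ln].
  by split=> /contains4P[i [j [k [l [[ij jk kl ln]]]]]];
    have := h i j k l ij jk kl ln; rewrite /evil4 /same_order /=; lia.
apply/negP => /or4P[] h; [case: h1 | case: h2 | case: h3 | case: h4];
  apply/contains4P; exists i, j, k, l; split=> //;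
  move: h; rewrite /same_order /=; lia.
Qed.

Lemma rectangularP n (s : 'S_n) : reflect (rectangular s) (avoid4 rect4 s).
Proof.
apply: (iffP (avoid4P _ _)) => [h|[h1 h2 h3 h4] i j k l ij jk kl ln].
  by split=> /contains4P[i [j [k [l [[ij jk kl ln]]]]]];
    have := h i j k l ij jk kl ln; rewrite /rect4 /same_order /=; lia.
apply/negP => /or4P[] h; [case: h1 | case: h2 | case: h3 | case: h4];
  apply/contains4P; exists i, j, k, l; split=> //;
  move: h; rewrite /same_order /=; lia.
Qed.

(** * Insertions into evil-avoiding permutations *)

Lemma app_ins_id n i j (s : 'S_n) : i <= n -> j <= n -> app (ins i j s) i = j.
Proof. by move=> hi hj; rewrite app_ins // eqxx. Qed.

Lemma evil_del n i j (s : 'S_n) : avoid4 evil4 (ins i j s) -> avoid4 evil4 s.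
Proof. exact: (avoid4_del evil4_bump). Qed.

(** No forbidden pattern starts with its minimum. *)
Lemma evil_ins_first n (s : 'S_n) : avoid4 evil4 s -> avoid4 evil4 (ins 0 0 s).
Proof.
move=> h; apply: (avoid4_ins evil4_bump) => // a b c d ab bc cd dn f q.
have f0 : f 0 = 0 by apply: app_ins_id.
rewrite !inE => hin; have a0 : a = 0 by lia.
by move: q; rewrite a0 f0 /evil4; lia.
Qed.

(** No forbidden pattern ends with its minimum. *)
Lemma evil_ins_last n (s : 'S_n) : avoid4 evil4 s -> avoid4 evil4 (ins n 0 s).
Proof.
move=> h; apply: (avoid4_ins evil4_bump) => // a b c d ab bc cd dn f q.
have f0 : f n = 0 by apply: app_ins_id.
rewrite !inE => hin; have d0 : d = n by lia.
by move: q; rewrite d0 f0 /evil4; lia.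
Qed.

(** Positions [i], [i.+1] carry [j], [j.+1]. No forbidden pattern has two adjacent letters [m],
    [m+1], so an occurrence uses at most one of the twins, and the other can replace it. *)
Lemma evil_ins_twin n i j (s : 'S_n) : i < n -> j <= n ->
  app (ins i j s) i.+1 = j.+1 -> avoid4 evil4 s -> avoid4 evil4 (ins i j s).
Proof.
move=> hi hj; set f := app (ins i j s) => f1 h.
have f0 : f i = j by apply: app_ins_id => //; apply: ltnW.
have fE x : (f x == j.+1) = (x == i.+1).
  by rewrite -f1 (inj_eq (@app_inj _ _)).
apply: (avoid4_ins evil4_bump) => //; first exact: ltnW.
rewrite -/f /= => a b c d ab bc cd dn q.
have := fE a; have := fE b; have := fE c; have := fE d => ed ec eb ea.
rewrite !inE => /or4P[] /eqP e.
- exists i.+1, b, c, d; move: q ab bc cd dn ea eb ec ed.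
  by rewrite -e f0 f1 !inE /evil4; lia.
- exists a, i.+1, c, d; move: q ab bc cd dn ea eb ec ed.
  by rewrite -e f0 f1 !inE /evil4; lia.
- exists a, b, i.+1, d; move: q ab bc cd dn ea eb ec ed.
  by rewrite -e f0 f1 !inE /evil4; lia.
- exists a, b, c, i.+1; move: q ab bc cd dn ea eb ec ed.
  by rewrite -e f0 f1 !inE /evil4; lia.
Qed.

Lemma evil_ins_twin_first n (s : 'S_n.+1) :
  avoid4 evil4 s -> avoid4 evil4 (ins 0 (app s 0) s).
Proof.
have hv : app s 0 <= n by rewrite -ltnS app_lt.
apply: evil_ins_twin => //; first exact: leqW.
by rewrite app_ins ?leqW //= (_ : unbump 0 1 = 0) // /bump leqnn.
Qed.

Lemma evil_ins_twin0 n (s : 'S_n.+1) :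
  avoid4 evil4 s -> avoid4 evil4 (ins (app s^-1 0) 0 s).
Proof.
have hp : app s^-1 0 <= n by rewrite -ltnS app_lt.
apply: evil_ins_twin => //.
rewrite app_ins ?leqW // ifF; last lia.
by rewrite (_ : unbump _ _ = app s^-1 0) ?appVK // /unbump; lia.
Qed.

Definition below_first_increasing n (s : 'S_n) : bool :=
  [forall a : 'I_n, forall b : 'I_n, (s a < s b) && (s b < app s 0) ==> (a < b)].

Lemma below_first_increasingP n (s : 'S_n) :
  reflect (forall a b, app s a < app s b -> app s b < app s 0 -> a < b)
          (below_first_increasing s).
Proof.
apply: (iffP forallP) => [h a b ab b0|h a]; last first.
  by apply/forallP=> b; apply/implyP; rewrite -!app_ord => /andP[]; apply: h.
have n0 : 0 < n.
  by case: (posnP n) => // e; subst; move: ab b0; rewrite !app_ge //; lia.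
have bn : b < n by move: (app_lt s b); have := app_lt s 0; lia.
have an : a < n by move: (app_lt s a); have := app_lt s b; lia.
move/forallP: (h (Ordinal an)) => /(_ (Ordinal bn)).
by rewrite -!app_ord /= ab b0.
Qed.

(** A minimum in second place can only be the 1 of 4132. The letters 3 and 2 would then be a
    decrease below the first entry. *)
Lemma evil_ins_second n (s : 'S_n.+1) : below_first_increasing s ->
  avoid4 evil4 s -> avoid4 evil4 (ins 1 0 s).
Proof.
move=> /below_first_increasingP inc h.
apply: (avoid4_ins evil4_bump) => // a b c d ab bc cd dn f q.
have f1 : f 1 = 0 by apply: app_ins_id.
have f0 : f 0 = (app s 0).+1 by rewrite /f app_ins.
have fS x : 1 < x -> f x = (app s x.-1).+1.
  move=> hx; rewrite /f app_ins // ifF; last lia.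
  by rewrite (_ : unbump 1 x = x.-1) // /unbump; lia.
rewrite !inE => hin; case: (eqVneq a 1) => [ea|na].
  by move: q; rewrite ea f1 /evil4; lia.
have a0 : a = 0 by lia.
have b1 : b = 1 by lia.
have := inc d.-1 c.-1.
by move: q; rewrite a0 b1 f0 f1 (fS c) ?(fS d) /evil4; lia.
Qed.

(** * Evil-avoiding permutations with 0 past the second place, not last and not followed by 1 *)

Section Structure.
Variables (n : nat) (s : 'S_n).
Let f := app s.
Let p := app s^-1 0.
Hypothesis s_evil : avoid4 evil4 s.
Hypotheses (p_gt1 : 1 < p) (p_last : p.+1 < n) (fpS : f p.+1 != 1).

Let fp : f p = 0. Proof. exact: appVK. Qed.
Let f_eq a b : (f a == f b) = (a == b). Proof. exact: (inj_eq (@app_inj _ s)). Qed.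

Let evilN a b c d : a < b -> b < c -> c < d -> d < n ->
  ~~ evil4 (f a) (f b) (f c) (f d).
Proof. by move=> *; apply: (avoid4P _ _ s_evil). Qed.

Let no2413 a b c d : a < b -> b < c -> c < d -> d < n ->
  f c < f a -> f a < f d -> f d < f b -> False.
Proof. by move=> ab bc cd dn h1 h2 h3; have := evilN ab bc cd dn; rewrite /evil4 h1 h2 h3. Qed.

Let no4132 a b c d : a < b -> b < c -> c < d -> d < n ->
  f b < f d -> f d < f c -> f c < f a -> False.
Proof.
by move=> ab bc cd dn h1 h2 h3; have := evilN ab bc cd dn; rewrite /evil4 h1 h2 h3 orbT.
Qed.

Let no4213 a b c d : a < b -> b < c -> c < d -> d < n ->
  f c < f b -> f b < f d -> f d < f a -> False.
Proof.
by move=> ab bc cd dn h1 h2 h3; have := evilN ab bc cd dn; rewrite /evil4 h1 h2 h3 !orbT.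
Qed.

Let no3214 a b c d : a < b -> b < c -> c < d -> d < n ->
  f c < f b -> f b < f a -> f a < f d -> False.
Proof.
by move=> ab bc cd dn h1 h2 h3; have := evilN ab bc cd dn; rewrite /evil4 h1 h2 h3 !orbT.
Qed.

Let f_gt0 a : a != p -> 0 < f a.
Proof. by rewrite -f_eq fp lt0n. Qed.

Let fpS_gt1 : 1 < f p.+1.
Proof. by have := @f_gt0 p.+1; lia. Qed.

Let o := app s^-1 1.
Let fo : f o = 1. Proof. exact: appVK. Qed.
Let on : o < n. Proof. by rewrite app_lt; lia. Qed.
Let o_neq : (o != p) && (o != p.+1).
Proof. by rewrite -(f_eq o p) -(f_eq o p.+1) fo fp /= eq_sym. Qed.

(* Let [z] be the entry after 0. If the value 1 comes after [z], it completes a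
   4132 with [x], 0, [z]; if it comes before 0, a 4213. *)
Let lt_after_zero x : x < p -> f p.+1 < f x -> x < o -> False.
Proof.
move=> xp zx xo; case: (ltngtP o p) => op.
- apply: (@no4213 x o p p.+1) => //; rewrite ?fo ?fp //.
- apply: (@no4132 x p p.+1 o) => //; rewrite ?fo ?fp //.
  by move: o_neq; lia.
- by move: o_neq; rewrite op eqxx.
Qed.

(** Otherwise [f 0], [f b], 0 decrease. The entry after 0 completes 3214 if it exceeds [f 0] and
    4213 if it lies between [f b] and [f 0]; if it is below [f b], [lt_after_zero] applies. *)
Lemma first_minimal_before_zero b : 0 < b -> b < p -> f 0 < f b.
Proof.
move=> b0 bp; rewrite ltnNge leq_eqVlt f_eq gtn_eqF //=; apply/negP => b_lt.
have fb : f p < f b by rewrite fp f_gt0 // ltn_eqF.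
have p0 : 0 < p by apply: ltnW.
case: (ltngtP (f p.+1) (f b)) => [zb|zb|/eqP]; last by rewrite f_eq; lia.
  apply: (@lt_after_zero 0) => //; first exact: ltn_trans b_lt.
  by rewrite lt0n; apply/eqP => e; move: b_lt; rewrite -e fo; lia.
case: (ltngtP (f p.+1) (f 0)) => [z0|z0|/eqP]; last by rewrite f_eq.
  exact: (@no4213 0 b p p.+1).
exact: (@no3214 0 b p p.+1).
Qed.

(** Suppose [f 1] exceeds [f 0 + 1], and let [x] be the position of [f 0 + 1]. If [x] is after 0,
    then [f 0], [f 1], 0, [f x] form 2413. If it is before, [f 1], [f x], 0 decrease, and the entry
    after 0 gives 4213, 3214 or a case of [lt_after_zero]. *)
Lemma second_is_succ : f 1 = (f 0).+1.
Proof.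
have v1 := first_minimal_before_zero (isT : 0 < 1) p_gt1.
apply/eqP; rewrite eq_sym eqn_leq v1 leqNgt /=; apply/negP => v2.
have p0 : 0 < p by apply: ltnW.
have f0 : 0 < f 0 by rewrite f_gt0 // ltn_eqF.
pose x := app s^-1 (f 0).+1.
have fx : f x = (f 0).+1 by apply: appVK.
have f1n : f 1 < n by rewrite app_lt (ltn_trans p_gt1) // ltnW.
have xn : x < n by rewrite app_lt (ltn_trans v2).
have x1 : 1 < x.
  case: (x) fx => [|[|//]] e; first by move: e; lia.
  by move: v2; rewrite e ltnn.
case: (ltngtP x p) => xp; last by move: fp; rewrite -xp fx.
  case: (ltnP (f p.+1) (f x)) => zx.
    have z0 : f p.+1 < f 0 by rewrite ltn_neqAle f_eq -ltnS -fx.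
    apply: (@lt_after_zero 0) => //.
    by rewrite lt0n; apply/eqP => e; move: z0; rewrite -e fo ltnNge ltnW.
  have {}zx : f x < f p.+1 by rewrite ltn_neqAle f_eq zx ltn_eqF // ltnW.
  have fpx : f p < f x by rewrite fx fp.
  case: (ltngtP (f p.+1) (f 1)) => [z1|z1|/eqP]; last by rewrite f_eq; lia.
    exact: (@no4213 1 x p p.+1).
  by apply: (@no3214 1 x p p.+1) => //; rewrite fx.
by apply: (@no2413 0 1 p x) => //; rewrite ?fp ?fx.
Qed.

(** Entries below the first cannot precede 0. A decrease among them after 0 would form 4132 with the
    first entry and 0. *)
Lemma below_first_increasing_evil : below_first_increasing s.
Proof.
apply/below_first_increasingP => a b; rewrite -/f => ab b0.
have after_p c : f c < f 0 -> p <= c.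
  move=> c0; rewrite leqNgt; apply/negP => cp.
  case: (posnP c) => hc; first by move: c0; rewrite hc ltnn.
  by have := first_minimal_before_zero hc cp; rewrite ltnNge ltnW.
have pa := after_p a (ltn_trans ab b0); have pb := after_p b b0.
have p0 : 0 < p by apply: ltnW.
have f0n : f 0 < n by rewrite app_lt (ltn_trans p0) // ltnW.
have an : a < n by rewrite -(app_lt s) -/f (ltn_trans ab) // (ltn_trans b0).
case: (ltngtP a b) => // ba; last by move: ab; rewrite ba ltnn.
have {}pb : p < b.
  by rewrite ltn_neqAle pb andbT; apply/eqP => e; move: ab; rewrite -e fp.
have fpa : f p < f a by rewrite fp f_gt0 // gtn_eqF // (ltn_trans pb).
by exfalso; apply: (@no4132 0 p b a).
Qed.

End Structure.

(** * Insertions into rectangular permutations *)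

Lemma app_insL n i j (s : 'S_n) k : i <= n -> j <= n -> k < i ->
  app (ins i j s) k = bump j (app s k).
Proof.
move=> hi hj ki; rewrite app_ins // ltn_eqF //.
by rewrite (_ : unbump i k = k) // /unbump; lia.
Qed.

Lemma app_insR n i j (s : 'S_n) k : i <= n -> j <= n -> i <= k ->
  app (ins i j s) k.+1 = bump j (app s k).
Proof.
move=> hi hj ki; rewrite app_ins // gtn_eqF //.
by rewrite (_ : unbump i k.+1 = k) // /unbump; lia.
Qed.

Lemma appV_eq n (s : 'S_n) i x : app s i = x -> app s^-1 x = i.
Proof. by move<-; apply: appK. Qed.

Lemma app_eq n (s : 'S_n) a b : (app s a == app s b) = (a == b).
Proof. exact: (inj_eq (@app_inj _ s)). Qed.

Lemma bump0 a : bump 0 a = a.+1.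
Proof. by []. Qed.

Lemma rect_del n i j (s : 'S_n) : avoid4 rect4 (ins i j s) -> avoid4 rect4 s.
Proof. exact: (avoid4_del rect4_bump). Qed.

Lemma rect_ins_first n (s : 'S_n) : avoid4 rect4 s -> avoid4 rect4 (ins 0 0 s).
Proof.
move=> h; apply: (avoid4_ins rect4_bump) => // a b c d ab bc cd dn f q.
have f0 : f 0 = 0 by apply: app_ins_id.
rewrite !inE => hin; have a0 : a = 0 by lia.
by move: q; rewrite a0 f0 /rect4; lia.
Qed.

(** No forbidden pattern has its minimum among its first two letters, so no condition on [s] like
    that of [evil_ins_second] arises. *)
Lemma rect_ins_second n (s : 'S_n.+1) :
  avoid4 rect4 s -> avoid4 rect4 (ins 1 0 s).
Proof.
move=> h; apply: (avoid4_ins rect4_bump) => // a b c d ab bc cd dn f q.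
have f1 : f 1 = 0 by apply: app_ins_id.
rewrite !inE => hin; case: (eqVneq a 1) => [ea|na].
  by move: q; rewrite ea f1 /rect4; lia.
have b1 : b = 1 by lia.
by move: q; rewrite b1 f1 /rect4; lia.
Qed.

(** An occurrence through position 0 is moved to position 1, whose value is adjacent to [j]. *)
Lemma rect_ins_twin n j (s : 'S_n.+1) : j <= n.+1 ->
  j = app s 0 \/ j = (app s 0).+1 ->
  avoid4 rect4 s -> avoid4 rect4 (ins 0 j s).
Proof.
move=> hj hj'; set f := app (ins 0 j s) => h.
have f0 : f 0 = j by apply: app_ins_id.
have f1 : (f 1 == j.+1) || ((f 1).+1 == j).
  by rewrite /f app_insR // /bump; lia.
have fE x : (f x == f 1) = (x == 1) by apply: app_eq.
apply: (avoid4_ins rect4_bump) => //.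
rewrite -/f /= => a b c d ab bc cd dn q.
rewrite !inE => hin; have a0 : a = 0 by lia.
have := fE b; have := fE c; have := fE d => ed ec eb.
exists 1, b, c, d; move: q; rewrite a0 f0 !inE /= => q.
(* In every pattern the letter 3 lies strictly between the first two letters, but the values at
   positions 0 and 1 are consecutive. *)
have b1 : b != 1.
  by apply/eqP => e; move: q f1; rewrite e /rect4; lia.
have {}eb : f b != f 1 by rewrite eb.
have {}ec : f c != f 1 by rewrite ec; lia.
have {}ed : f d != f 1 by rewrite ed; lia.
apply/and5P; split; [lia|lia|lia|lia|].
apply/andP; split; first lia.
by move: q f1 eb ec ed; clear; rewrite /rect4; lia.
Qed.

(** If the second entry [w] is none of these, then 0 and the neighbour [t] of the first entry [v] on
    the side of [w] both come later. Since [t] lies strictly between [v] and [w], these four entries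
    form a forbidden pattern. *)
Lemma rect_second n (s : 'S_n.+2) : avoid4 rect4 s -> app s 0 != 0 ->
  [|| app s 1 == 0, app s 1 == (app s 0).-1 | app s 1 == (app s 0).+1].
Proof.
move=> /avoid4P h f0; apply/negP => /negP; rewrite !negb_or => /and3P[n0 np nS].
have ne : app s 1 != app s 0 by rewrite app_eq.
have lt0 : app s 0 < n.+2 by rewrite app_lt.
have lt1 : app s 1 < n.+2 by rewrite app_lt.
have fz : app s (app s^-1 0) = 0 by apply: appVK.
have zpos : 1 < app s^-1 0.
  by case E : (app s^-1 0) fz => [|[|]] // e; move: f0 n0; rewrite e.
have zn : app s^-1 0 < n.+2 by rewrite app_lt.
have no_rect x y : x < y -> y < n.+2 -> 1 < x -> ~~ rect4 (app s 0) (app s 1) (app s x) (app s y).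
  by move=> xy yn x1; apply: h.
pose t := if app s 1 < app s 0 then (app s 0).-1 else (app s 0).+1.
have tE : t = (app s 0).-1 /\ app s 1 < app s 0 \/ t = (app s 0).+1 /\ app s 0 < app s 1.
  by rewrite /t; case: ltnP => ?; [left|right]; split=> //; lia.
have ft : app s (app s^-1 t) = t by apply: appVK.
have tpos : 1 < app s^-1 t.
  case E : (app s^-1 t) ft => [|[|]] // e; case: tE => -[]; lia.
have tn : app s^-1 t < n.+2 by rewrite app_lt; case: tE => -[]; lia.
case: (ltngtP (app s^-1 0) (app s^-1 t)) => zt.
- have := no_rect _ _ zt tn zpos; rewrite fz ft /rect4.
  by case: tE => -[-> ?]; lia.
- have := no_rect _ _ zt zn tpos; rewrite fz ft /rect4.
  by case: tE => -[-> ?]; lia.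
- by move: ft; rewrite -zt fz; case: tE => -[-> ?]; lia.
Qed.

(** * Generating polynomials *)

Definition gf n (P : pred 'S_n) : {poly int} := (\sum_(s | P s) 'X^(recoils s))%R.

Lemma eq_gf n (P R : pred 'S_n) : P =1 R -> gf P = gf R.
Proof. by move=> h; apply: eq_bigl. Qed.

Lemma gf_split n (C P : pred 'S_n) :
  gf P = (gf (fun s => P s && C s) + gf (fun s => P s && ~~ C s))%R.
Proof. exact: bigID. Qed.

Lemma gf_pred0 n (P : pred 'S_n) : (forall s, ~~ P s) -> gf P = 0%R.
Proof. by move=> h; rewrite /gf big_pred0 // => s; apply/negbTE/h. Qed.

(** Every term of the recurrences arises this way: [g] restricts to a bijection from [R] to [P] that
    adds [c] recoils. *)
Lemma gf_image m n c (g : 'S_n -> 'S_m) (P : pred 'S_m) (R : pred 'S_n) :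
  (forall s t, g s = g t -> s = t) ->
  (forall s, R s -> P (g s) /\ recoils (g s) = recoils s + c) ->
  (forall p, P p -> exists2 s, R s & p = g s) ->
  gf P = ('X^c * gf R)%R.
Proof.
move=> g_inj gR gP; rewrite /gf mulr_sumr.
rewrite (eq_bigl (mem [set g s | s in R])) => [|p].
  rewrite big_imset => [|s t _ _]; last exact: g_inj.
  by apply: eq_bigr => s /gR[_ ->]; rewrite addnC exprD.
apply/idP/imsetP => [/gP[s Rs ->]|[s Rs ->]]; first by exists s.
by case: (gR s Rs).
Qed.

(** This is [A_n] for the class given by [Q]; the next definition is [U_n]. *)
Definition avoid_gf Q n := gf (fun s : 'S_n => avoid4 Q s).
Definition avoid_gf_nz Q n := gf (fun s : 'S_n => avoid4 Q s && (app s 0 != 0)).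

Lemma recoils_ins_first n (s : 'S_n) : recoils (ins 0 0 s) = recoils s.
Proof.
case: n s => [|n] s; last by rewrite recoils_ins0 // ltn0 addn0.
by rewrite recoilsE big_ord0 /recoils eq_card0 // => -[].
Qed.

Lemma ins_first_surj n (p : 'S_n.+1) : app p 0 = 0 -> exists s, p = ins 0 0 s.
Proof. by move=> p0; have [s] := ins_surj p (leq0n n); rewrite p0; exists s. Qed.

Lemma avoid_gf_rec Q n : 
  (forall h a b c d, Q (bump h a) (bump h b) (bump h c) (bump h d) = Q a b c d) ->
  (forall s : 'S_n, avoid4 Q s -> avoid4 Q (ins 0 0 s)) ->
  avoid_gf Q n.+1 = (avoid_gf Q n + avoid_gf_nz Q n.+1)%R.
Proof.
move=> Q_bump Q_ins; rewrite {1}/avoid_gf (gf_split (fun s => app s 0 == 0)).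
congr (_ + _)%R; rewrite -[RHS]mul1r -(expr0 'X%R).
apply: (@gf_image _ _ 0 (ins 0 0)) => [s t|s hs|p /andP[hp /eqP p0]].
- by apply: ins_inj => //; left.
- by rewrite Q_ins // app_ins_id // recoils_ins_first addn0.
- have [s e] := ins_first_surj p0; exists s => //.
  by move: hp; rewrite e; apply: avoid4_del.
Qed.

Lemma ins_split n (p : 'S_n.+1) i : i <= n ->
  exists j s, j <= n /\ p = ins i j s.
Proof.
move=> hi; have [s e] := ins_surj p hi.
by exists (app p i), s; split=> //; rewrite -ltnS app_lt.
Qed.

Lemma app0_le n (s : 'S_n.+1) : app s 0 <= n.
Proof. by rewrite -ltnS app_lt. Qed.

Lemma ins_twin_inj n (s t : 'S_n.+1) :
  ins 0 (app s 0) s = ins 0 (app t 0) t -> s = t.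
Proof. by apply: ins_inj; rewrite ?leqW ?app0_le //; left. Qed.

Lemma ins_twinS_inj n (s t : 'S_n.+1) :
  ins 0 (app s 0).+1 s = ins 0 (app t 0).+1 t -> s = t.
Proof. by apply: ins_inj; rewrite ?ltnS ?app0_le //; left. Qed.

Lemma ins_second_inj n (s t : 'S_n.+1) : ins 1 0 s = ins 1 0 t -> s = t.
Proof. by apply: ins_inj => //; left. Qed.

Lemma ins_10_inj n (s t : 'S_n) :
  ins 1 0 (ins 0 0 s) = ins 1 0 (ins 0 0 t) -> s = t.
Proof. by move/ins_second_inj; apply: ins_inj => //; left. Qed.

Lemma recoils_ins_10 n (s : 'S_n) :
  recoils (ins 1 0 (ins 0 0 s)) = recoils s + 1.
Proof.
rewrite recoils_ins0 // recoils_ins_first (_ : app _ 0 = 0) //.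
by apply: appV_eq; rewrite app_ins_id.
Qed.

Lemma rect_nz_rec n : avoid_gf_nz rect4 n.+2 =
  ('X * avoid_gf rect4 n + (2%:R + 'X) * avoid_gf_nz rect4 n.+1)%R.
Proof.
rewrite {1}/avoid_gf_nz (gf_split (fun s => app s 1 == (app s 0).+1)).
rewrite [X in (_ + X)%R](gf_split (fun s => app s 1 == 0)).
rewrite [X in (_ + (X + _))%R](gf_split (fun s => app s 0 == 1)).
(* Start [v v+1]: delete the first entry. *)
have -> : gf (fun s : 'S_n.+2 => (avoid4 rect4 s && (app s 0 != 0)) &&
    (app s 1 == (app s 0).+1)) = avoid_gf_nz rect4 n.+1.
  rewrite -[RHS]mul1r -(expr0 'X%R).
  apply: (gf_image (@ins_twin_inj n)) => [s /andP[hs s0]|p].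
    have le := app0_le s.
    rewrite rect_ins_twin ?leqW //; last by left.
    rewrite app_ins_id ?leqW // app_insR ?leqW // s0 /bump leqnn.
    by rewrite recoils_ins_before addn0 add1n eqxx.
  have [j [s [hj ->]]] := ins_split p (leq0n n.+1).
  rewrite app_ins_id // app_insR // => /andP[/andP[/rect_del hs j0] /eqP e].
  have {}e : j = app s 0 by move: e; rewrite /bump; lia.
  by exists s; rewrite ?hs -?e.
(* Start [1 0]: delete both entries, losing the recoil they form. *)
have -> : gf (fun s : 'S_n.+2 => (((avoid4 rect4 s && (app s 0 != 0)) &&
    (app s 1 != (app s 0).+1)) && (app s 1 == 0)) && (app s 0 == 1)) =
    ('X * avoid_gf rect4 n)%R.
  rewrite -['X%R in RHS]expr1.
  apply: (gf_image (@ins_10_inj n)) => [s hs|p].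
    rewrite rect_ins_second ?rect_ins_first // app_ins_id // app_insL //.
    by rewrite app_ins_id // recoils_ins_10.
  have [j [s [hj ->]]] := ins_split p (isT : 1 <= n.+1).
  rewrite app_ins_id // app_insL // => /andP[/andP[/andP[/andP[/rect_del hs _] _] /eqP e]].
  rewrite e bump0 eqSS => /eqP s0; move: hs.
  have [t ->] := ins_first_surj s0.
  by move/rect_del => ht; exists t.
(* Start [v 0] with [v >= 2]: delete 0. The value 1 comes after it, so no recoil is lost. *)
have -> : gf (fun s : 'S_n.+2 => (((avoid4 rect4 s && (app s 0 != 0)) &&
    (app s 1 != (app s 0).+1)) && (app s 1 == 0)) && (app s 0 != 1)) =
    avoid_gf_nz rect4 n.+1.
  rewrite -[RHS]mul1r -(expr0 'X%R).
  apply: (gf_image (@ins_second_inj n)) => [s /andP[hs s0]|p].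
    have e : (app s^-1 0 == 0) = false by rewrite app_V0 eq_sym (negPf s0).
    rewrite rect_ins_second // app_ins_id // app_insL // bump0 recoils_ins0 //.
    by rewrite ltnS leqn0 e eqSS s0.
  have [j [s [hj ->]]] := ins_split p (isT : 1 <= n.+1).
  rewrite app_ins_id // app_insL // => /andP[/andP[/andP[/andP[/rect_del hs _] _] /eqP e]].
  rewrite e bump0 eqSS => s0; by exists s; rewrite ?hs.
(* By [rect_second] only the start [v v-1] with [v-1] nonzero is left: delete the first entry,
   losing one recoil. *)
have -> : gf (fun s : 'S_n.+2 => ((avoid4 rect4 s && (app s 0 != 0)) &&
    (app s 1 != (app s 0).+1)) && (app s 1 != 0)) =
    ('X * avoid_gf_nz rect4 n.+1)%R.
  rewrite -['X%R in RHS]expr1.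
  apply: (gf_image (@ins_twinS_inj n)) => [s /andP[hs s0]|p].
    have le := app0_le s.
    rewrite rect_ins_twin //; last by right.
    rewrite app_ins_id // app_insR // recoils_ins_after addn1.
    by split=> //; rewrite /bump; lia.
  case/andP=> /andP[/andP[hp p0] p1] pz; have := rect_second hp p0.
  rewrite (negPf p1) (negPf pz) orbF /=; move: hp p0 p1 pz.
  have [j [s [hj ->]]] := ins_split p (leq0n n.+1).
  rewrite app_ins_id // app_insR // => /rect_del hs j0 e1 e2 e3.
  have e : j = (app s 0).+1 by move: e1 e2 e3; rewrite /bump; lia.
  exists s; last by rewrite e.
  by rewrite hs //=; move: e1 e2 e3; rewrite /bump; lia.
by ring.
Qed.

(** * Recurrences for the evil-avoiding class *)

Definition linked n (s : 'S_n.+1) : bool :=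
  [&& avoid4 evil4 s, app s 0 != 0, app s^-1 0 != n &
      app s (app s^-1 0).+1 != 1].

Definition rising n (s : 'S_n.+1) : bool :=
  [&& avoid4 evil4 s, app s 0 != 0, app s 0 < app s 1 &
      below_first_increasing s].

Lemma ins_last_inj n (s t : 'S_n) : ins n 0 s = ins n 0 t -> s = t.
Proof. by apply: ins_inj => //; left. Qed.

Lemma appV0_le n (s : 'S_n.+1) : app s^-1 0 <= n.
Proof. exact: app0_le. Qed.

Lemma ins_twin0_inj n (s t : 'S_n.+1) :
  ins (app s^-1 0) 0 s = ins (app t^-1 0) 0 t -> s = t.
Proof. by apply: ins_inj; rewrite ?leqW ?app0_le //; right. Qed.

Lemma appV_ins0 n i (s : 'S_n) : i <= n -> app (ins i 0 s)^-1 0 = i.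
Proof. by move=> hi; apply: appV_eq; rewrite app_ins_id. Qed.

Lemma ins_at_pos0 n (p : 'S_n.+1) : exists s, p = ins (app p^-1 0) 0 s.
Proof.
by have [s] := ins_surj p (appV0_le p); rewrite appVK; exists s.
Qed.

Lemma ins0_next n i (s : 'S_n.+1) : i <= n.+1 ->
  (app (ins i 0 s) i.+1 == 1) = (i == app s^-1 0).
Proof.
move=> hi; rewrite app_insR // bump0 eqSS.
by rewrite -{1}(appVK s 0) app_eq.
Qed.

(** The three terms are: 0 is last, and its removal loses one recoil; 0 is followed by 1, and the
    two are contracted; the rest is [linked]. *)
Lemma evil_nz_linked_rec n : avoid_gf_nz evil4 n.+2 =
  ('X * avoid_gf evil4 n.+1 + avoid_gf_nz evil4 n.+1 + gf (@linked n.+1))%R.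
Proof.
rewrite {1}/avoid_gf_nz (gf_split (fun s => app s^-1 0 == n.+1)).
rewrite [X in (_ + X)%R](gf_split (fun s => app s (app s^-1 0).+1 == 1)).
rewrite addrA; congr (_ + _ + _)%R; last by apply: eq_gf => s; rewrite /linked -!andbA.
  rewrite -['X%R in RHS]expr1.
  apply: (gf_image (@ins_last_inj n.+1)) => [s hs|p].
    rewrite evil_ins_last // appV_ins0 // eqxx app_insL // recoils_ins0 //.
    by rewrite ltnS appV0_le.
  have [s e] := ins_at_pos0 p; case/andP=> /andP[hp _] /eqP e0.
  by move: e hp; rewrite {}e0 => -> /evil_del hs; exists s.
rewrite -[RHS]mul1r -(expr0 'X%R).
apply: (gf_image (@ins_twin0_inj n)) => [s /andP[hs s0]|p].
  have le := appV0_le s; have le' := leqW le.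
  rewrite evil_ins_twin0 // appV_ins0 // ins0_next // eqxx.
  have p0 : 0 < app s^-1 0 by rewrite lt0n app_V0 eq_sym.
  by rewrite recoils_ins0 // ltnn addn0 app_insL // bump0 (ltn_eqF (le : _ < n.+1)).
have [s e] := ins_at_pos0 p; have le := appV0_le p.
rewrite e appV_ins0 // ins0_next // => /andP[/andP[/andP[/evil_del hs p0] _] /eqP ep].
exists s; last by rewrite -ep.
rewrite hs //=; apply: contra p0 => /eqP s0.
by rewrite ep (appV_eq s0) app_ins_id.
Qed.

(* The bijection doubles a leading entry [v] into [v v+1]. *)
Lemma linked_contract n :
  gf (fun s : 'S_n.+3 => linked s && (app s 1 != 0)) = gf (@linked n.+1).
Proof.
rewrite -[RHS]mul1r -(expr0 'X%R).
have shift (s : 'S_n.+2) j : j <= n.+2 -> 0 < j ->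
    app (ins 0 j s)^-1 0 = (app s^-1 0).+1.
  by move=> hj j0; apply: appV_eq; rewrite app_insR // appVK /bump; lia.
apply: (gf_image (@ins_twin_inj n.+1)) => [s /and4P[hs s0 sl s1]|p].
  have le := leqW (app0_le s).
  rewrite /linked evil_ins_twin_first // recoils_ins_before addn0.
  rewrite app_ins_id // shift ?lt0n // !app_insR // s0 eqSS sl /bump leqnn /=.
  by split=> //; move: s1; lia.
case/andP=> /and4P[hp p0 pl p1] pz.
have p_gt1 : 1 < app p^-1 0.
  by case E : (app p^-1 0) (appVK p 0) => [|[|]] // e; move: p0 pz; rewrite e.
have pn : (app p^-1 0).+1 < n.+3.
  by rewrite ltn_neqAle eqSS pl app_lt.
have := second_is_succ hp p_gt1 pn p1; move: hp p0 pl p1 pz {p_gt1 pn}.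
have [j [s [hj ->]]] := ins_split p (leq0n n.+2).
rewrite app_ins_id // => /evil_del hs j0.
rewrite shift ?lt0n // !app_insR // => sl s1 _ e.
have {}e : j = app s 0 by move: e; rewrite /bump; lia.
exists s; last by rewrite e.
rewrite /linked hs //= -e j0 -eqSS sl /=.
(* If the entry after 0 were 1 in [s] but not after the insertion, then [j] would be 1. That entry
   would equal the first entry. *)
have : app s (app s^-1 0).+1 != app s 0 by rewrite app_eq.
by rewrite -e => ne; apply: contra s1 => /eqP e1; rewrite e1 /bump in ne *; lia.
Qed.

Lemma linked_small (s : 'S_2) : ~~ linked s.
Proof.
apply/negP => /and4P[_ s0 s1 _].
by have := appV0_le s; have := app_V0 s 0; lia.
Qed.

Lemma rising_small (s : 'S_2) : ~~ rising s.
Proof.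
by apply/negP => /and4P[_ s0 s1 _]; have := app_lt s 1; lia.
Qed.

Lemma evil_ins_10 n (s : 'S_n) :
  avoid4 evil4 s -> avoid4 evil4 (ins 1 0 (ins 0 0 s)).
Proof.
move=> hs; apply: evil_ins_second; last exact: evil_ins_first.
apply/below_first_increasingP => a b _.
by rewrite app_ins_id.
Qed.

(** The starts [1 0], [v w] with [w] nonzero, and [v 0] with [v >= 2] give the three terms, in this
    order. *)
Lemma linked_rec n : gf (@linked n.+2) =
  ('X * avoid_gf evil4 n.+1 + gf (@linked n.+1) + gf (@rising n.+1))%R.
Proof.
rewrite (gf_split (fun s => app s 1 != 0)) linked_contract.
rewrite [X in (_ + X)%R](gf_split (fun s => app s 0 == 1)).
rewrite [LHS]addrCA -addrA; congr (_ + (_ + _))%R.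
  rewrite -['X%R in RHS]expr1.
  apply: (gf_image (@ins_10_inj n.+1)) => [s hs|p].
    rewrite /linked evil_ins_10 // appV_ins0 // app_insL // app_ins_id //.
    by rewrite ins0_next // appV_ins0 // app_ins_id // recoils_ins_10.
  have [j [s [hj ->]]] := ins_split p (isT : 1 <= n.+2).
  rewrite app_ins_id // app_insL // => /andP[/andP[/and4P[/evil_del hs _ _ _]]].
  rewrite negbK => /eqP e; rewrite e bump0 eqSS => /eqP s0; move: hs.
  have [t ->] := ins_first_surj s0.
  by move/evil_del => ht; exists t.
rewrite -[RHS]mul1r -(expr0 'X%R).
apply: (gf_image (@ins_second_inj n.+1)) => [s /and4P[hs s0 s1 sinc]|p].
  have q0 : app s^-1 0 != 0 by rewrite app_V0 eq_sym.
  have q1 : app s^-1 0 != 1.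
    by apply/eqP => e; move: s1; have := appVK s 0; rewrite e => ->.
  rewrite /linked evil_ins_second // appV_ins0 // app_insL // app_ins_id //.
  rewrite ins0_next // recoils_ins0 // ltnS leqn0 (negPf q0) addn0.
  by rewrite bump0 eqSS s0 (eq_sym 1) q1.
have [j [s [hj ->]]] := ins_split p (isT : 1 <= n.+2).
rewrite app_ins_id // negbK => /andP[/andP[/and4P[hp _ _ p1] /eqP e] p0].
move: hp p1 p0; rewrite {j hj}e => hp; rewrite appV_ins0 // ins0_next //.
rewrite app_insL // bump0 eqSS => p1 s0; exists s => //.
(* A decrease below the first entry of [s] would form 4132 with the first entry and the inserted
   0. *)
have inc a b : app s a < app s b -> app s b < app s 0 -> a < b.
  move=> ab b0; case: (ltngtP a b) => // [ba|e]; last by move: ab; rewrite e ltnn.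
  have bpos : 0 < b by rewrite lt0n; apply/eqP => e; move: b0; rewrite e ltnn.
  have an : a < n.+2.
    rewrite -(app_lt s); apply: (leq_trans (ltn_trans ab b0)).
    exact: leqW (app0_le s).
  move/avoid4P: hp => /(_ 0 1 b.+1 a.+1 isT bpos ba an).
  have apos : 0 < a by apply: ltn_trans ba.
  by rewrite app_ins_id // app_insL // !app_insR // !bump0 /evil4 !ltnS ab b0 orbT.
apply/and4P; split=> //; [exact: evil_del hp| |exact/below_first_increasingP].
(* If the second entry were below the first, the increasing order would put 0 before position 1,
   hence first. *)
have z1 : app s^-1 0 != 0 by rewrite app_V0 eq_sym.
have zn := appV0_le s.
case: (ltngtP (app s 0) (app s 1)) => // [lt|/eqP]; last by rewrite app_eq.
have /inc : app s (app s^-1 0) < app s 1.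
  by rewrite appVK lt0n -[X in _ != X](appVK s 0) app_eq.
by move=> /(_ lt); lia.
Qed.

Lemma ins_last_first_inj n (s t : 'S_n) :
  ins n.+1 0 (ins 0 0 s) = ins n.+1 0 (ins 0 0 t) -> s = t.
Proof. by move/ins_last_inj; apply: ins_inj => //; left. Qed.

(** If 0 is last, the first entry is 1, and both are removed. If 0 is neither last nor followed by
    1, the structure lemmas identify the case with the one counted by [linked_contract]. If 0 is
    followed by 1, contracting them stays in [rising]. *)
Lemma rising_rec n : gf (@rising n.+2) =
  ('X * avoid_gf evil4 n.+1 + gf (@linked n.+1) + gf (@rising n.+1))%R.
Proof.
rewrite (gf_split (fun s => app s (app s^-1 0).+1 == 1)).
(* When 0 is last, [app] returns its argument [n.+3] at the next position, so this case belongs to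
   the part not followed by 1. *)
rewrite [X in (_ + X)%R](gf_split (fun s => app s^-1 0 == n.+2)) addrC.
have pos_gt1 m (s : 'S_m.+2) : app s 0 != 0 -> app s 1 != 0 -> 1 < app s^-1 0.
  by case E : (app s^-1 0) (appVK s 0) => [|[|]] // e; rewrite e.
congr (_ + _ + _)%R.
- rewrite -['X%R in RHS]expr1.
  apply: (gf_image (@ins_last_first_inj n.+1)) => [s hs|p].
    have hd : app (ins n.+2 0 (ins 0 0 s)) 0 = 1.
      by rewrite app_insL // app_ins_id.
    rewrite /rising evil_ins_last ?evil_ins_first // hd app_insL // app_insR //.
    rewrite appV_ins0 // ins0_next // appV_ins0 // eqxx recoils_ins0 //.
    rewrite appV_ins0 // recoils_ins_first !andbT; split=> //.
    by apply/below_first_increasingP => a b ab; rewrite hd; lia.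
  have [s e] := ins_at_pos0 p; case/andP=> /andP[/and4P[hp p0 _ inc] _] /eqP ep.
  (* If the first entry exceeded 1, the increasing order would put 1 after 0, which is last. *)
  have p0E : app p 0 = 1.
    apply/eqP; rewrite eqn_leq lt0n p0 andbT leqNgt; apply/negP => p1.
    move/below_first_increasingP/(_ (app p^-1 0) (app p^-1 1)): inc.
    rewrite !appVK => /(_ isT p1); have := app_lt p^-1 1; rewrite ep; lia.
  move: e hp p0E; rewrite {}ep => -> /evil_del.
  rewrite app_insL // bump0 => hs [] /ins_first_surj [t et].
  by move: hs; rewrite et => /evil_del ht; exists t.
- rewrite -linked_contract; apply: eq_gf => s.
  apply/andP/andP => [[/andP[/and4P[hs s0 s1 _] sn] sl]|[hl s1]].
    by split; [apply/and4P | rewrite -lt0n (leq_ltn_trans _ s1)].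
  have /and4P[hs s0 sl sn] := hl; split=> //; apply/andP; split=> //.
  have p1 := pos_gt1 _ _ s0 s1.
  have pn : (app s^-1 0).+1 < n.+3 by rewrite ltn_neqAle eqSS sl app_lt.
  rewrite /rising hs s0 (second_is_succ hs p1 pn sn) leqnn.
  exact: below_first_increasing_evil hs p1 pn sn.
rewrite -[RHS]mul1r -(expr0 'X%R).
apply: (gf_image (@ins_twin0_inj n.+1)) => [s /and4P[hs s0 s1 sinc]|p].
  have q1 : 1 < app s^-1 0 by apply: pos_gt1; rewrite // -lt0n (leq_ltn_trans _ s1).
  have qn := leqW (appV0_le s); have q0 := ltnW q1.
  rewrite /rising evil_ins_twin0 // appV_ins0 // ins0_next // eqxx.
  rewrite recoils_ins0 // ltnn !app_insL // !bump0 ltnS s1 /= addn0 andbT; split=> //.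
  apply/below_first_increasingP => a b.
  have -> : app (ins (app s^-1 0) 0 s) 0 = (app s 0).+1 by rewrite app_insL.
  move/below_first_increasingP: sinc => inc.
  rewrite !app_ins //; case: (eqVneq b (app s^-1 0)) => // bq.
  (* The inserted 0 stands just before the old 0, which precedes every other entry below the
     first. *)
  case: (eqVneq a (app s^-1 0)) => [->|aq]; rewrite !bump0 !ltnS => ab b0.
    case: (posnP (app s (unbump (app s^-1 0) b))) => [/appV_eq|sb].
      by move: bq; rewrite /unbump; lia.
    have := inc (app s^-1 0) (unbump (app s^-1 0) b).
    by rewrite appVK => /(_ sb b0); rewrite /unbump; lia.
  by have := inc _ _ ab b0; rewrite /unbump; lia.
have [s e] := ins_at_pos0 p; have le := appV0_le p.
case/andP=> /and4P[hp p0 p1 /below_first_increasingP inc]; rewrite {1 2}e.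
rewrite appV_ins0 // ins0_next // => /eqP eq.
have q1 : 1 < app p^-1 0.
  by apply: pos_gt1; rewrite // -lt0n (leq_ltn_trans _ p1).
have q0 := ltnW q1.
exists s; last by rewrite -eq.
rewrite e in hp p1 inc; rewrite !app_insL // !bump0 ltnS in p1.
rewrite /rising (evil_del hp) p1 /= eq_sym -app_V0 -eq gtn_eqF //=.
apply/below_first_increasingP => a b ab b0.
have ba x : app (ins (app p^-1 0) 0 s) (bump (app p^-1 0) x) = (app s x).+1.
  by rewrite app_ins // bumpK ifF // /bump; lia.
have := inc (bump (app p^-1 0) a) (bump (app p^-1 0) b).
by rewrite !ba app_insL // ltn_bump bump0 !ltnS; apply.
Qed.

(** * Equality of the generating polynomials *)

Lemma avoid_gf0 : avoid_gf evil4 0 = avoid_gf rect4 0.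
Proof.
by apply: eq_gf => s; apply/avoid4P/avoid4P.
Qed.

Lemma avoid_gf_nz1 Q : avoid_gf_nz Q 1 = 0%R.
Proof.
apply: gf_pred0 => s; rewrite negb_and negbK.
by have := app0_le s; rewrite leqn0 => ->; rewrite orbT.
Qed.

Lemma linked_rising n : gf (@linked n.+1) = gf (@rising n.+1).
Proof.
case: n => [|n]; last by rewrite linked_rec rising_rec.
by rewrite !gf_pred0 //; [exact: rising_small | exact: linked_small].
Qed.

Lemma evil_gf_rec n : avoid_gf evil4 n.+1 = (avoid_gf evil4 n + avoid_gf_nz evil4 n.+1)%R.
Proof. by apply: avoid_gf_rec; [exact: evil4_bump | exact: evil_ins_first]. Qed.

Lemma rect_gf_rec n : avoid_gf rect4 n.+1 = (avoid_gf rect4 n + avoid_gf_nz rect4 n.+1)%R.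
Proof. by apply: avoid_gf_rec; [exact: rect4_bump | exact: rect_ins_first]. Qed.

(** With [rising] replaced by [linked], the recurrences of the two sides differ only in one term,
    which the induction hypothesis identifies. *)
Lemma linked_gf n : gf (@linked n.+1) = avoid_gf_nz evil4 n.+1.
Proof.
elim: n => [|n IH].
  by rewrite avoid_gf_nz1 gf_pred0 //; exact: linked_small.
by rewrite linked_rec -linked_rising evil_nz_linked_rec !IH.
Qed.

Lemma evil_nz_rec n : avoid_gf_nz evil4 n.+2 =
  ('X * avoid_gf evil4 n + (2%:R + 'X) * avoid_gf_nz evil4 n.+1)%R.
Proof. by rewrite evil_nz_linked_rec linked_gf evil_gf_rec; ring. Qed.

(** The induction carries [A_n] together with [U_(n+1)], because each step consumes both. *)
Lemma evil_rect_gf n : avoid_gf evil4 n = avoid_gf rect4 n.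
Proof.
suff [] : avoid_gf evil4 n = avoid_gf rect4 n /\
          avoid_gf_nz evil4 n.+1 = avoid_gf_nz rect4 n.+1 by [].
elim: n => [|n [IH1 IH2]]; first by rewrite avoid_gf0 !avoid_gf_nz1.
by rewrite evil_gf_rec rect_gf_rec evil_nz_rec rect_nz_rec IH1 IH2.
Qed.

(** * From equal coefficients to a bijection *)

Lemma coef_avoid_gf Q n k :
  ((avoid_gf Q n)`_k = #|[set s : 'S_n | avoid4 Q s && (recoils s == k)]|%:R)%R.
Proof.
rewrite /avoid_gf /gf coef_sum -sum1dep_card natr_sum [RHS]big_mkcondr /=.
by apply: eq_bigr => s _; rewrite coefXn eq_sym; case: eqP.
Qed.

Lemma equal_card_bij (T : finType) (A B : {set T}) : #|A| = #|B| ->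
  exists f : T -> T, [/\ {in A, forall x, f x \in B}, {in A &, injective f} &
    {in B, forall y, exists2 x, x \in A & f x = y}].
Proof.
(* Elements of equal rank in the two enumerations are matched; the default [x] only matters outside
   [A]. *)
move=> AB; exists (fun x => nth x (enum B) (index x (enum A))).
have idx x : x \in A -> index x (enum A) < size (enum B).
  by move=> xA; rewrite -cardE -AB cardE index_mem mem_enum.
split=> [x xA|x y xA yA|y yB].
- by rewrite -mem_enum mem_nth // idx.
- rewrite (set_nth_default y) ?idx // => /eqP.
  rewrite nth_uniq ?enum_uniq ?idx // => /eqP e.
  by rewrite -(nth_index x (_ : x \in enum A)) ?mem_enum // e nth_index // mem_enum.
have yi : index y (enum B) < size (enum A).
  by rewrite -cardE AB cardE index_mem mem_enum.
exists (nth y (enum A) (index y (enum B))); first by rewrite -mem_enum mem_nth.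
rewrite index_uniq ?enum_uniq // (set_nth_default y) ?nth_index ?mem_enum //.
by rewrite index_mem mem_enum.
Qed.

Theorem theorem1p10 (n k : nat) (hn : (1 <= n)%N) :
  exists f : {perm 'I_n} -> {perm 'I_n},
    (forall pi, evil_avoiding pi /\ recoils pi = k ->
                rectangular (f pi) /\ recoils (f pi) = k) /\
    (forall pi1 pi2, evil_avoiding pi1 /\ recoils pi1 = k ->
                     evil_avoiding pi2 /\ recoils pi2 = k ->
                     f pi1 = f pi2 -> pi1 = pi2) /\
    (forall tau, rectangular tau /\ recoils tau = k ->
                 exists2 pi, evil_avoiding pi /\ recoils pi = k & f pi = tau).
Proof.
pose E := [set s : 'S_n | avoid4 evil4 s && (recoils s == k)].
pose B := [set s : 'S_n | avoid4 rect4 s && (recoils s == k)].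
have EP s : reflect (evil_avoiding s /\ recoils s = k) (s \in E).
  by rewrite inE; apply: (iffP andP) => -[/evil_avoidingP h /eqP ?]; split=> //; apply/eqP.
have BP s : reflect (rectangular s /\ recoils s = k) (s \in B).
  by rewrite inE; apply: (iffP andP) => -[/rectangularP h /eqP ?]; split=> //; apply/eqP.
have card_EB : #|E| = #|B|.
  (* The coefficients of ['X^k] are the two cardinals cast to integers, and this cast is
     injective. *)
  have := congr1 (fun p : {poly int} => p`_k)%R (evil_rect_gf n).
  by rewrite !coef_avoid_gf => /eqP; rewrite Num.Theory.eqr_nat => /eqP.
have [f [fB f_inj f_surj]] := equal_card_bij card_EB.
exists f; split=> [s /EP/fB/BP //|]; split=> [s t /EP sE /EP tE|t /BP/f_surj].
  exact: f_inj.
by case=> s /EP sE fs; exists s.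
Qed.
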